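(* The infinite word $f^\omega(0)$ contains no factor of the form $X_1YX_2$ with $X_1,Y,X_2\in\Sigma^*$, $X_1Y$ nonempty, $X_1\sim X_2$ and $$\frac{|X_1YX_2|}{|X_1Y|}>\frac{876775}{489527}\approx 1.79107.$$
   Context: Let $\Sigma=\{0,1,\ldots,7\}$ and let $\Sigma^*$ be the set of finite words over $\Sigma$ (including the empty word $\epsilon$), with concatenation. $|u|$ is the length of the word $u$ and $|u|_a$ is the number of occurrences of the letter $a$ in $u$. For $u,v\in\Sigma^*$, $u\sim v$ ($u$ is an anagram of $v$) means $|u|_a=|v|_a$ for every $a\in\Sigma$. A word $v$ is a factor of a finite word $u$ if $u=pvs$ for some words $p,s$; a factor of an infinite word is a factor of one of its finite prefixes. A morphism is a map $h:\Sigma^*\to\Sigma^*$ with $h(uv)=h(u)h(v)$; it is determined by its values on letters. Let $\sigma:\Sigma^*\to\Sigma^*$ be the morphism with $\sigma(a)\equiv a+1\pmod 8$ for $a\in\Sigma$. Let $f:\Sigma^*\to\Sigma^*$ be the morphism given by $f(0)=0740103050260$ and $f(\sigma^n(0))=\sigma^n(f(0))$ for every integer $n$ (so $f(k)=\sigma^k(0740103050260)$ for each letter $k$). Since $0$ is a prefix of $f(0)$, each $f^n(0)$ is a prefix of $f^{n+1}(0)$; $f^\omega(0)$ is the infinite word having $f^n(0)$ as a prefix for every $n$. *)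

(* Defs.v *)
From mathcomp Require Import all_boot all_order all_algebra.

Set Implicit Arguments.
Unset Strict Implicit.
Unset Printing Implicit Defensive.

Import GRing.Theory.
Local Open Scope ring_scope.

(* The alphabet {0, ..., 7}, with the addition of integers modulo 8. *)
Notation letter := 'Z_8.
Notation word := (seq letter).

Definition anagram (u v : word) : Prop :=
  forall a : letter, count_mem a u = count_mem a v.

Lemma anagramP u v : reflect (anagram u v) (perm_eq u v).
Proof.
apply: (iffP idP) => [/permP uv a|uv]; first exact: uv.
by apply/allP => a _; apply/eqP/uv.
Qed.

Definition sigma (u : word) : word := [seq a + 1 | a <- u].

Definition f0 : word := [:: 0; 7; 4; 0; 1; 0; 3; 0; 5; 0; 2; 6; 0].

Definition f (u : word) : word := flatten [seq iter (val a) sigma f0 | a <- u].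

Lemma f_cat u v : f (u ++ v) = f u ++ f v.
Proof. by rewrite /f map_cat flatten_cat. Qed.

Lemma iter_sigma n u : iter n sigma u = [seq a + n%:R | a <- u].
Proof.
elim: n => [|n IHn] /=; first by under eq_map do rewrite addr0; rewrite map_id.
rewrite IHn /sigma -map_comp; apply: eq_map => a /=.
by rewrite -addrA -natr1.
Qed.

Lemma f_iter_sigma n : f (iter n sigma [:: 0]) = iter n sigma (f [:: 0]).
Proof.
have E a : f [:: a] = [seq b + a | b <- f0].
  by rewrite /f /= cats0 iter_sigma natr_Zp.
rewrite !iter_sigma [[seq _ | _ <- [:: 0]]]/= !E add0r -[in RHS]map_comp.
by apply: eq_map => b /=; rewrite addr0.
Qed.

(* The i-th letter is read off f^i(0), whose length 13^i exceeds i; the default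
   value of nth is therefore never used. *)
Definition fomega (i : nat) : letter := nth 0 (iter i f [:: 0]) i.

Lemma size_iter_f n : size (iter n f [:: 0]) = (13 ^ n)%N.
Proof.
elim: n => // n IHn; rewrite iterS expnS -IHn.
elim: (iter n f _) => [|a u IHu] //=.
by rewrite /f /= size_cat IHu iter_sigma size_map mulnS.
Qed.

Lemma prefix_iter_f m n : (m <= n)%N ->
  prefix (iter m f [:: 0]) (iter n f [:: 0]).
Proof.
move=> /subnK <-; elim: (n - m)%N => [|k IHk]; first exact: prefix_refl.
apply: prefix_trans IHk _; rewrite addSn; elim: (k + m)%N => // j /prefixP[s E].
by rewrite [iter j.+1 _ _]iterS [iter j.+2 _ _]iterS E f_cat prefix_prefix.
Qed.

Lemma fomega_prefix n :
  mkseq fomega (size (iter n f [:: 0])) = iter n f [:: 0].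
Proof.
apply: (@eq_from_nth _ 0); rewrite size_mkseq // => i ltin.
rewrite nth_mkseq // /fomega.
have lti : (i < size (iter i f [:: 0%R]))%N by rewrite size_iter_f ltn_expl.
by case: (leqP i n) => [le|/ltnW le]; have /prefixP[s ->] := prefix_iter_f le;
  rewrite nth_cat ?lti ?ltin.
Qed.

Definition factor_infinite (v : word) (w : nat -> letter) : Prop :=
  exists n : nat, infix v (mkseq w n).

(* Main.v *)
From Stdlib Require Import ZArith.
Require Import Defs.
From mathcomp Require Import all_boot all_order all_algebra.
From mathcomp Require Import zify lra.
Local Open Scope ring_scope.
Delimit Scope Z_scope with Z.

Set Implicit Arguments.
Unset Strict Implicit.
Unset Printing Implicit Defensive.
Import Order.TTheory GRing.Theory Num.Theory.

(** Write w for the infinite word.  A factor X1 Y X2 with X1 and X2 anagrams is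
    given by four positions n0 <= n1 <= n2 <= n3, the ends of X1 and of X2, at
    which the prefix counts of w satisfy N(n0) + N(n3) - N(n1) - N(n2) = 0 for
    every letter.  The proof shows that then |X1| <= 3 |Y|, that is, the ratio
    never exceeds 7/4, which is below the required constant.

    The morphism is 13-uniform, and f(c) contains every letter once plus five
    more copies of c.  Hence, for n = 13 q + r, the prefix count of a letter a is
    N_a(n) = q + 5 N_a(q) + (a count inside the first r letters of f(w_q)),
    see [prefix_count_block].  Dividing the four positions by 13 gives four
    parent positions whose defect vector D(q), D = N(n0) + N(n3) - N(n1) - N(n2),
    is about one fifth of a bounded perturbation of D(n).  So the ancestors of
    a repetition have uniformly small defects: their l1-norm is at most 4
    ([balanced_norm]).  This is not visible coordinatewise; it follows from the
    inductive bound D(A) <= 2 on the sum of D over any set A of at most three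
    letters ([balanced_parent]), for D and for - D.

    A repetition with |X1| > 3 |Y| also satisfies 4 (n1 + 1) > 3 n2 + n0, and
    this inequality passes to the parent positions because n1 + 1 is at most
    13 (q1 + 1).  Four positions with these properties are called alive, and
    iterating the division leads from any of them to (0, 0, 0, 0).

    What the children of a quadruple look like depends only on its state: the
    gaps n1 - n0 and n2 - n1, the excess n0 + n3 - n1 - n2, the letters of w at
    the four positions, and D.  As f commutes with adding a constant to all
    letters, letters may be taken relative to the letter at n0.  Going down
    from (0, 0, 0, 0), only finitely many states are met (about 1500, with gaps
    below 50): the inequality leaves too little room and the congruence of D
    modulo 5 too few choices for long quadruples to survive.  None of these
    states has D = 0 and n1 - n0 > 3 (n2 - n1), as [states_closed] and
    [states_harmless] check by computation. *)

(** * Letters and prefix counts of the infinite word *)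

Lemma nth_f u q r : (q < size u)%N -> (r < 13)%N ->
  nth 0 (f u) (13 * q + r) = nth 0 u q + nth 0 f0 r.
Proof.
move=> ltq ltr; elim: u q ltq => [|c u IHu] [|q] //= ltq.
  rewrite muln0 add0n /f /= nth_cat iter_sigma size_map ltr (nth_map 0) //.
  by rewrite natr_Zp addrC.
rewrite /f /= nth_cat iter_sigma size_map mulnS -addnA ltnNge leq_addr /=.
by rewrite addKn; apply: IHu.
Qed.

Lemma fomega_nth n i : (i < 13 ^ n)%N -> fomega i = nth 0 (iter n f [:: 0]) i.
Proof.
by rewrite -size_iter_f => lti; rewrite -fomega_prefix nth_mkseq.
Qed.

Lemma fomega_block q r : (r < 13)%N ->
  fomega (13 * q + r) = fomega q + nth 0 f0 r.
Proof.
move=> ltr; have ltq : (q < 13 ^ q)%N by apply: ltn_expl.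
rewrite (@fomega_nth q.+1); last first.
  apply: (@leq_trans (13 * q.+1)); last by rewrite expnS leq_mul2l.
  by rewrite mulnS addnC ltn_add2r.
by rewrite (fomega_nth ltq) iterS nth_f // size_iter_f.
Qed.

Definition prefix_count (P : pred letter) (n : nat) : Z :=
  Z.of_nat (count P (mkseq fomega n)).

Lemma prefix_countS P n :
  prefix_count P n.+1 = (prefix_count P n + Z.of_nat (P (fomega n)))%Z.
Proof.
by rewrite /prefix_count mkseqS -cats1 count_cat /= addn0; lia.
Qed.

Definition letters : seq letter := [seq inZp i | i <- iota 0 8].

Lemma mem_letters a : a \in letters.
Proof.
by apply/mapP; exists (val a); rewrite ?valZpK // mem_iota /= ltn_ord.
Qed.

Lemma uniq_letters : uniq letters.
Proof. by vm_compute. Qed.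

(** The one property of [f0] behind the recursion for counts: five more zeros
    than a permutation of the alphabet. *)
Lemma f0_letters : perm_eq f0 (nseq 5 0 ++ letters).
Proof. by vm_compute. Qed.

Lemma count_image P c :
  count P [seq a + c | a <- f0] = (#|P| + 5 * P c)%N.
Proof.
rewrite (permP (perm_map _ f0_letters)) map_cat count_cat map_nseq add0r.
rewrite count_nseq mulnC addnC; congr addn; rewrite cardE -size_filter.
apply: perm_size; apply: uniq_perm.
- by rewrite filter_uniq // map_inj_uniq ?uniq_letters //; apply: addIr.
- exact: enum_uniq.
move=> a; rewrite mem_filter mem_enum andbC.
suff -> : a \in [seq b + c | b <- letters] by [].
by apply/mapP; exists (a - c); rewrite ?mem_letters ?subrK.
Qed.

(** Each complete block f(w_i) contributes one occurrence of every letter and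
    five extra ones of w_i, which is how the count at [q] enters. *)
Lemma prefix_count_block P q r : (r < 13)%N ->
  prefix_count P (13 * q + r) =
  (Z.of_nat #|P| * Z.of_nat q + 5 * prefix_count P q +
   Z.of_nat (count P [seq (a + fomega q)%R | a <- take r f0]))%Z.
Proof.
have partial q' r' : (r' <= 13)%N -> prefix_count P (13 * q' + r') =
    (prefix_count P (13 * q') +
     Z.of_nat (count P [seq (a + fomega q')%R | a <- take r' f0]))%Z.
  elim: r' => [|k IHk] ltk; first by rewrite take0 addn0 /=; lia.
  rewrite addnS prefix_countS IHk 1?ltnW // fomega_block //.
  rewrite (take_nth 0) // map_rcons -cats1 count_cat /= addn0 addrC.
  by case: (P _); lia.
move=> ltr; rewrite partial 1?ltnW //; congr Z.add.
elim: q => [|q IHq]; first by rewrite muln0 /prefix_count /=; lia.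
rewrite mulnSr partial // IHq (take_oversize (s := f0)) // count_image.
rewrite prefix_countS; move: #|P| (prefix_count P q) => k x.
by case: (P _); lia.
Qed.

(** * The defect of four positions and its bounds *)

(** For a factor X1 Y X2 between the positions [n0 <= n1 <= n2 <= n3] this
    is the number of occurrences of [P] in X2 minus that in X1. *)
Definition defect (P : pred letter) (n0 n1 n2 n3 : nat) : Z :=
  (prefix_count P n0 + prefix_count P n3 -
   prefix_count P n1 - prefix_count P n2)%Z.

Definition excess (n0 n1 n2 n3 : nat) : Z :=
  (Z.of_nat n0 + Z.of_nat n3 - Z.of_nat n1 - Z.of_nat n2)%Z.

Definition block_count (P : pred letter) (q r : nat) : Z :=
  Z.of_nat (count P [seq (a + fomega q)%R | a <- take r f0]).

Lemma defect_block P q0 q1 q2 q3 r0 r1 r2 r3 :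
  (r0 < 13)%N -> (r1 < 13)%N -> (r2 < 13)%N -> (r3 < 13)%N ->
  defect P (13 * q0 + r0) (13 * q1 + r1) (13 * q2 + r2) (13 * q3 + r3) =
  (Z.of_nat #|P| * excess q0 q1 q2 q3 + 5 * defect P q0 q1 q2 q3 +
   (block_count P q0 r0 + block_count P q3 r3 -
    block_count P q1 r1 - block_count P q2 r2))%Z.
Proof.
move=> lt0 lt1 lt2 lt3; rewrite /defect /excess /block_count.
rewrite !prefix_count_block //.
by move: #|P| => k; ring.
Qed.

(** The sets of three letters matter: bounds on one and two letters alone would
    allow eight entries 1 and -1, hence not bound the l1-norm by 4. *)
Definition balanced (n0 n1 n2 n3 : nat) : Prop :=
  forall A : seq letter, uniq A -> (size A <= 3)%N ->
    (defect (mem A) n0 n1 n2 n3 <= 2)%Z.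

(** The first [r] letters of f(c) are [center_count r] copies of c and
    [r - center_count r] other letters, pairwise distinct. *)
Definition center_count (r : nat) : nat := count_mem 0 (take r f0).

(** A set of [k] letters meets such a prefix most often when it contains c and
    as many as possible of the other letters that occur, and least often when it
    avoids c and contains as many as possible of the other letters that do not
    occur. *)
Definition max_block (k r : nat) : nat :=
  if k is k'.+1 then center_count r + minn k' (r - center_count r) else 0.

Definition min_block (k r : nat) : nat := (r - center_count r) - (7 - k).

Fixpoint lists (k : nat) : seq (seq letter) :=
  if k is k'.+1 then [seq a :: A | a <- letters, A <- lists k'] else [:: [::]].

Lemma mem_lists A : A \in lists (size A).
Proof.
elim: A => // a A IHA; apply/allpairsPdep; exists a, A.
by rewrite mem_letters.
Qed.

Lemma lists_bounds :
  all (fun k => all (fun A => uniq A ==> all (fun r =>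
    min_block k r <= count (mem A) (take r f0) <= max_block k r)%N
    (iota 0 13)) (lists k)) (iota 0 4).
Proof. by vm_compute. Qed.

(** Translating the set by the letter at [q] reduces every block to [f0]. *)
Lemma block_count_bounds A q r : uniq A -> (size A <= 3)%N -> (r < 13)%N ->
  (Z.of_nat (min_block (size A) r) <= block_count (mem A) q r
    <= Z.of_nat (max_block (size A) r))%Z.
Proof.
move=> uA leA ltr; pose B := [seq a - fomega q | a <- A].
have eB : size B = size A by rewrite size_map.
have uB : uniq B by rewrite map_inj_uniq //; apply: addIr.
have -> : block_count (mem A) q r = Z.of_nat (count (mem B) (take r f0)).
  rewrite /block_count count_map; congr Z.of_nat; apply: eq_count => a /=.
  by rewrite -(mem_map (addIr (- fomega q))) addrK.
have /allP/(_ (size B)) := lists_bounds.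
rewrite mem_iota eB ltnS => /(_ leA)/allP/(_ B); rewrite -{1}eB.
move=> /(_ (mem_lists B)); rewrite uB => /allP/(_ r).
rewrite mem_iota => /(_ ltr); move: (count _ _) (min_block _ _) (max_block _ _).
by clear => c m M /andP[]; lia.
Qed.

Definition block_bounds (k : nat) : seq (Z * Z * Z) :=
  [seq (Z.of_nat r, Z.of_nat (min_block k r), Z.of_nat (max_block k r))
  | r <- iota 0 13].

Definition balance_check (k : nat) : bool :=
  let S := block_bounds k in
  all (fun p0 => all (fun p1 => all (fun p2 => all (fun p3 =>
    let: (r0, m0, _) := p0 in let: (r1, _, M1) := p1 in
    let: (r2, _, M2) := p2 in let: (r3, m3, _) := p3 in
    let shift := (r0 + r3 - r1 - r2)%Z in
    let slack := (13 + (m0 + m3 - M1 - M2))%Z in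
    all (fun e => if (Z.abs (13 * e + shift) <=? 1)%Z
                  then (0 <? slack + Z.of_nat k * e)%Z else true)
        [:: (-1)%Z; 0%Z; 1%Z]) S) S) S) S.

Lemma balance_checked : all balance_check (iota 0 4).
Proof. by vm_compute. Qed.

(** Here [e] is the excess of the parents.  Estimating the four blocks
    separately falls short for three letters: the extreme cases are excluded
    because [13 * e] nearly cancels the shift of the remainders. *)
Lemma balance k r0 r1 r2 r3 e :
  (k < 4)%N -> (r0 < 13)%N -> (r1 < 13)%N -> (r2 < 13)%N -> (r3 < 13)%N ->
  (Z.abs (13 * e + (Z.of_nat r0 + Z.of_nat r3 - Z.of_nat r1 - Z.of_nat r2))
     <= 1)%Z ->
  (-13 < Z.of_nat k * e + (Z.of_nat (min_block k r0) + Z.of_nat (min_block k r3)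
            - Z.of_nat (max_block k r1) - Z.of_nat (max_block k r2)))%Z.
Proof.
move=> ltk lt0 lt1 lt2 lt3 small.
have /allP/(_ k) := balance_checked; rewrite mem_iota => /(_ ltk).
have unfold_all p r : (r < 13)%N -> all p (block_bounds k) ->
    p (Z.of_nat r, Z.of_nat (min_block k r), Z.of_nat (max_block k r)).
  move=> ltr; rewrite all_map => /allP/(_ r).
  by rewrite mem_iota => /(_ ltr).
move=> /(unfold_all _ _ lt0)/(unfold_all _ _ lt1)/(unfold_all _ _ lt2).
move=> /(unfold_all _ _ lt3)/and4P[].
have: (e = -1 \/ e = 0 \/ e = 1)%Z by lia.
have smallb := introT (Z.leb_spec0 _ _) small.
by move=> [] E; [|case: E => E]; rewrite E in small smallb *;
  rewrite smallb => H1 H2 H3 _; [move: H1|move: H2|move: H3] => /Z.ltb_spec0; lia.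
Qed.

(** With [k] the size of [A] and [e] the excess of the parents, five times the
    defect of the parents on [A] is at most [2 - (k * e + T)], [T] being the
    contribution of the incomplete blocks; by [balance] this is below 15. *)
Lemma balanced_parent q0 q1 q2 q3 r0 r1 r2 r3 :
  (r0 < 13)%N -> (r1 < 13)%N -> (r2 < 13)%N -> (r3 < 13)%N ->
  let n0 := (13 * q0 + r0)%N in let n1 := (13 * q1 + r1)%N in
  let n2 := (13 * q2 + r2)%N in let n3 := (13 * q3 + r3)%N in
  (Z.abs (excess n0 n1 n2 n3) <= 1)%Z ->
  balanced n0 n1 n2 n3 -> balanced q0 q1 q2 q3.
Proof.
move=> lt0 lt1 lt2 lt3 n0 n1 n2 n3 small bal A uA leA.
have := bal A uA leA; rewrite /n0 /n1 /n2 /n3 defect_block // (card_uniqP uA).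
have := block_count_bounds q0 uA leA lt0.
have := block_count_bounds q1 uA leA lt1.
have := block_count_bounds q2 uA leA lt2.
have := block_count_bounds q3 uA leA lt3.
set e := excess q0 q1 q2 q3; set k := size A in leA *.
have small13 : (Z.abs (13 * e + (Z.of_nat r0 + Z.of_nat r3 -
                         Z.of_nat r1 - Z.of_nat r2)) <= 1)%Z.
  by move: small; rewrite /e /excess /n0 /n1 /n2 /n3; lia.
have := balance leA lt0 lt1 lt2 lt3 small13.
move: (min_block k r0) (min_block k r3) (max_block k r1) (max_block k r2).
by lia.
Qed.

(** * Quadruples that may come from a long repetition *)

(** [alive_long] is the inequality that a repetition with |X1| > 3 |Y|
    satisfies, weakened just enough to be inherited by the parents.  The last
    field says that the opposite of the defect is balanced as well. *)
Record alive (n0 n1 n2 n3 : nat) : Prop := Alive {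
  alive_le01 : (n0 <= n1)%N;
  alive_le12 : (n1 <= n2)%N;
  alive_long : (3 * n2 + n0 < 4 * n1.+1)%N;
  alive_excess : (Z.abs (excess n0 n1 n2 n3) <= 1)%Z;
  alive_balanced : balanced n0 n1 n2 n3;
  alive_balancedN : balanced n1 n0 n3 n2 }.

Lemma excess_swap n0 n1 n2 n3 : excess n1 n0 n3 n2 = (- excess n0 n1 n2 n3)%Z.
Proof. by rewrite /excess; lia. Qed.

Lemma defect_swap P n0 n1 n2 n3 :
  defect P n1 n0 n3 n2 = (- defect P n0 n1 n2 n3)%Z.
Proof. by rewrite /defect; lia. Qed.

Lemma alive_parent q0 q1 q2 q3 r0 r1 r2 r3 :
  (r0 < 13)%N -> (r1 < 13)%N -> (r2 < 13)%N -> (r3 < 13)%N ->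
  alive (13 * q0 + r0) (13 * q1 + r1) (13 * q2 + r2) (13 * q3 + r3) ->
  alive q0 q1 q2 q3.
Proof.
move=> lt0 lt1 lt2 lt3 [le01 le12 long small bal balN]; split; try by lia.
- by move: small; rewrite /excess; lia.
- exact: balanced_parent small bal.
rewrite -Z.abs_opp -excess_swap in small.
exact: (balanced_parent lt1 lt0 lt3 lt2 small balN).
Qed.

Definition zsum (s : seq Z) : Z := foldr Z.add 0%Z s.

(** If the positive values had sum above 2, then three of them, or all of them
    when there are fewer, would already have sum above 2. *)
Lemma zsum_pos_le (T : eqType) (D : T -> Z) (s : seq T) :
  (forall A, subseq A s -> (size A <= 3)%N -> (zsum (map D A) <= 2)%Z) ->
  (zsum [seq Z.max 0 (D a) | a <- s] <= 2)%Z.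
Proof.
move=> small; pose P := [seq a <- s | (0 <? D a)%Z].
have -> : zsum [seq Z.max 0 (D a) | a <- s] = zsum (map D P).
  rewrite /P; elim: s {small P} => //= a s ->.
  by case: ifP => [/Z.ltb_spec0|/Z.ltb_spec0] /=; lia.
have subP : subseq P s by apply: filter_subseq.
have [leP|ltP] := leqP (size P) 3; first exact: small.
have := small (take 3 P) (subseq_trans (take_subseq _ _) subP).
rewrite size_take ltP leqnn => /(_ isT).
have posP : all (fun a => (0 <? D a)%Z) P by apply: filter_all.
case: P posP ltP {subP} => [|a [|b [|c P]]] //= /and4P[].
rewrite take0 => /Z.ltb_spec0 ? /Z.ltb_spec0 ? /Z.ltb_spec0 ?.
by move=> /= *; lia.
Qed.

Lemma defect_mem (A : seq letter) n0 n1 n2 n3 : uniq A ->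
  defect (mem A) n0 n1 n2 n3 =
  zsum [seq defect (pred1 a) n0 n1 n2 n3 | a <- A].
Proof.
have split_count n a B : a \notin B -> prefix_count (mem (a :: B)) n =
    (prefix_count (pred1 a) n + prefix_count (mem B) n)%Z.
  move=> notB; rewrite /prefix_count -Nat2Z.inj_add; congr Z.of_nat.
  elim: (mkseq _ n) => //= b s ->; rewrite inE plusE addnACA; congr addn.
  by case: eqP => [->|_] //=; rewrite (negbTE notB).
elim: A => [_|a A IHA] /=.
  by rewrite /defect /prefix_count !(eq_count (a2 := pred0)) // !count_pred0.
move=> /andP[notA uA]; rewrite -IHA // /defect !split_count //.
move: (prefix_count (pred1 a)) (prefix_count (mem A)) => pa pA.
by ring.
Qed.

(** A comparison of the l1-norm of [v] with [m] that stops at the first partial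
    sum above [m]. *)
Fixpoint norm_le (m : Z) (v : seq Z) : bool :=
  if v is x :: v' then
    let m' := (m - Z.abs x)%Z in if (m' <? 0)%Z then false else norm_le m' v'
  else true.

Lemma norm_leP m v : (zsum (map Z.abs v) <= m)%Z -> norm_le m v.
Proof.
have pos s : (0 <= zsum (map Z.abs s))%Z by elim: s => //= x s; lia.
elim: v m => //= x v IHv m le; case: ifP => [/Z.ltb_spec0|_].
  by have := pos v; lia.
by apply: IHv; lia.
Qed.

(** The positive part and the negative part of the defect each have sum at
    most 2. *)
Lemma balanced_norm (s : seq letter) n0 n1 n2 n3 : uniq s ->
  balanced n0 n1 n2 n3 -> balanced n1 n0 n3 n2 ->
  norm_le 4 [seq defect (pred1 a) n0 n1 n2 n3 | a <- s].
Proof.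
move=> us bal balN; apply: norm_leP; rewrite -map_comp.
pose D a := defect (pred1 a) n0 n1 n2 n3.
have pos : (zsum [seq Z.max 0 (D a) | a <- s] <= 2)%Z.
  apply: zsum_pos_le => A subA leA; have uA := subseq_uniq subA us.
  by rewrite -defect_mem //; apply: bal.
have neg : (zsum [seq Z.max 0 (- D a) | a <- s] <= 2)%Z.
  apply: (zsum_pos_le (D := fun a => (- D a)%Z)) => A subA leA.
  have uA := subseq_uniq subA us.
  under eq_map => a do rewrite -defect_swap.
  by rewrite -defect_mem //; apply: balN.
suff -> : zsum [seq (Z.abs \o D) a | a <- s] =
  (zsum [seq Z.max 0 (D a) | a <- s] + zsum [seq Z.max 0 (- D a) | a <- s])%Z.
  by lia.
by elim: s {us pos neg} => //= a s ->; lia.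
Qed.

(** * The finite set of states *)

Local Open Scope Z_scope.

(** The data of the prefix of length [r] of f(c): [r], the next letter of f(c)
    minus c, and the letter counts. *)
Definition prefix_row (c : letter) (r : nat) : Z * Z * seq Z :=
  (Z.of_nat r, Z.of_nat (val (nth 0%R f0 r)),
   [seq Z.of_nat (count_mem b [seq (a + c)%R | a <- take r f0])
   | b <- letters]).

Definition prefixes (c : letter) : seq (Z * Z * seq Z) :=
  [seq prefix_row c r | r <- iota 0 13].

Definition prefix_table := Eval vm_compute in [seq prefixes c | c <- letters].

Fixpoint addsub (u a b : seq Z) : seq Z :=
  match u, a, b with
  | x :: u', y :: a', z :: b' => (x + y - z) :: addsub u' a' b'
  | _, _, _ => [::]
  end.

(** A state is the list [:: l, g, e, x1, x2, x3 & D] of the gaps n1 - n0 and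
    n2 - n1, the excess, the letters at n1, n2, n3 minus the letter at n0, and
    the vector D whose entry number b is the defect of the letter b plus the
    letter at n0.  Its children are the states of the quadruples
    13 n_i + r_i, among those that pass the tests which [alive] implies.  The
    remainder r3 is determined by r0, r1, r2 and the new excess, which is -1, 0
    or 1.  The rotation makes D relative to the new letter at n0. *)
Definition children (s : seq Z) : seq (seq Z) :=
  if s is l :: g :: e :: x1 :: x2 :: x3 :: D then
    let table x := nth [::] prefix_table (Z.to_nat x) in
    let base := [seq 5 * d + e | d <- D] in
    let t1 := table x1 in let t2 := table x2 in let t3 := table x3 in
    flatten [seq let: (r0, y0, k0) := p0 in
      flatten [seq let: (r1, y1, k1) := p1 in
        let l' := 13 * l + r1 - r0 in
        if l' <? 0 then [::] else
        (* no choice of r2 can succeed *)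
        if l' + 4 <=? 3 * (13 * g - r1) then [::] else
        let u := addsub base k0 k1 in
        flatten [seq let: (r2, y2, k2) := p2 in
          let g' := 13 * g + r2 - r1 in
          if g' <? 0 then [::] else
          if l' + 4 <=? 3 * g' then [::] else
          let r := r1 + r2 - r0 - 13 * e in
          if r <? -1 then [::] else if 13 <? r then [::] else
          flatten [seq
            let r3 := r + e' in
            if r3 <? 0 then [::] else if 13 <=? r3 then [::] else
            let: (_, y3, k3) := nth (0, 0, [::]) t3 (Z.to_nat r3) in
            let v := addsub u k3 k2 in
            if norm_le 4 v then
              [:: [:: l', g', e', (x1 + y1 - y0) mod 8, (x2 + y2 - y0) mod 8,
                      (x3 + y3 - y0) mod 8 & rot (Z.to_nat y0) v]]
            else [::]
          | e' <- [:: -1; 0; 1]]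
        | p2 <- t2]
      | p1 <- t1]
    | p0 <- table 0]
  else [::].

Definition mem_state (S : seq (seq Z)) (s : seq Z) := has (all2 Z.eqb s) S.

Fixpoint explore (n : nat) (seen fresh : seq (seq Z)) : seq (seq Z) :=
  if n is n'.+1 then
    let new := foldl (fun acc s => if mem_state acc s then acc else
                 if mem_state seen s then acc else s :: acc)
                 [::] (flatten [seq children s | s <- fresh]) in
    explore n' (new ++ seen) new
  else seen.

(** The state of (0, 0, 0, 0). *)
Definition root : seq Z := nseq 14 0.

(** The search is complete after four rounds. *)
Definition states := Eval vm_compute in explore 4 [:: root] [:: root].

Lemma states_closed :
  all (fun s => all (mem_state states) (children s)) states.
Proof. by vm_compute. Qed.

Definition harmless (s : seq Z) : bool :=
  if s is l :: g :: _ :: _ :: _ :: _ :: D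
  then if all (Z.eqb 0) D then l <=? 3 * g else true else true.

Lemma states_harmless : all harmless states.
Proof. by vm_compute. Qed.

Close Scope Z_scope.

(** * Every alive quadruple has one of these states *)

Definition relative_letter (n0 n : nat) : Z :=
  Z.of_nat (val (fomega n - fomega n0)).

Definition state (n0 n1 n2 n3 : nat) : seq Z :=
  [:: Z.of_nat n1 - Z.of_nat n0, Z.of_nat n2 - Z.of_nat n1,
      excess n0 n1 n2 n3, relative_letter n0 n1, relative_letter n0 n2,
      relative_letter n0 n3
    & [seq defect (pred1 (b + fomega n0)%R) n0 n1 n2 n3 | b <- letters]]%Z.

Lemma prefix_tableE n0 n :
  nth [::] prefix_table (Z.to_nat (relative_letter n0 n)) =
  prefixes (fomega n - fomega n0).
Proof.
have -> : prefix_table = [seq prefixes c | c <- letters] by vm_compute.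
rewrite Nat2Z.id (nth_map 0) ?size_map ?size_iota ?ltn_ord //.
by rewrite (nth_map 0%N) ?size_iota ?ltn_ord // nth_iota ?ltn_ord // valZpK.
Qed.

Lemma all_flatten (T : Type) (p : pred T) (ss : seq (seq T)) :
  all p (flatten ss) = all (all p) ss.
Proof. by elim: ss => //= s ss IHss; rewrite all_cat IHss. Qed.

Lemma all_prefixes (p : pred (seq Z)) F c r : (r < 13)%N ->
  all p (flatten [seq F x | x <- prefixes c]) -> all p (F (prefix_row c r)).
Proof.
move=> ltr; rewrite all_flatten all_map all_map => /allP/(_ r).
by rewrite mem_iota => /(_ ltr).
Qed.

Lemma addsub_map (T : Type) (F G H : T -> Z) s :
  addsub (map F s) (map G s) (map H s) = [seq (F x + G x - H x)%Z | x <- s].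
Proof. by elim: s => //= x s ->. Qed.

(** A rotation by [a] is the translation by [a] because [letters] lists the
    residues in increasing order. *)
Lemma rot_letters T (F : letter -> T) (a : letter) :
  rot (val a) [seq F b | b <- letters] = [seq F (b + a) | b <- letters].
Proof.
rewrite -map_rot [RHS](map_comp F (fun b => b + a)); congr map.
have /allP := isT : all (fun a : letter =>
  rot (val a) letters == [seq b + a | b <- letters]) letters.
by move=> /(_ a (mem_letters a))/eqP.
Qed.

Lemma relative_letter_block q0 q r0 r : (r0 < 13)%N -> (r < 13)%N ->
  relative_letter (13 * q0 + r0) (13 * q + r) =
  ((relative_letter q0 q + Z.of_nat (val (nth 0%R f0 r)) -
    Z.of_nat (val (nth 0%R f0 r0))) mod 8)%Z.
Proof.
move=> lt0 lt; rewrite /relative_letter !fomega_block //.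
have -> : fomega q + f0`_r - (fomega q0 + f0`_r0) =
          (fomega q - fomega q0) + f0`_r - f0`_r0 by rewrite opprD addrACA addrA.
move: (fomega q - _) (f0`_r) (f0`_r0) => x y z.
have /allP/(_ x (mem_letters x)) := isT :
  all (fun x : letter => all (fun y : letter => all (fun z : letter =>
  Z.of_nat (val (x + y - z)%R) =?
  (Z.of_nat (val x) + Z.of_nat (val y) - Z.of_nat (val z)) mod 8)%Z
  letters) letters) letters.
move=> /allP/(_ y (mem_letters y))/allP/(_ z (mem_letters z)).
by move=> /Z.eqb_spec.
Qed.

Lemma block_count_letter q0 q r b :
  block_count (pred1 (b + fomega q0)) q r =
  Z.of_nat (count_mem b [seq a + (fomega q - fomega q0) | a <- take r f0]).
Proof.
rewrite /block_count !count_map; congr Z.of_nat; apply: eq_count => a /=.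
by rewrite addrA -(inj_eq (addIr (fomega q0)) _ b) subrK.
Qed.

(** The tests in [children] never discard an alive quadruple, and the data they
    produce are those of the actual positions. *)
Lemma children_state (p : pred (seq Z)) q0 q1 q2 q3 r0 r1 r2 r3 :
  (r0 < 13)%N -> (r1 < 13)%N -> (r2 < 13)%N -> (r3 < 13)%N ->
  let n0 := (13 * q0 + r0)%N in let n1 := (13 * q1 + r1)%N in
  let n2 := (13 * q2 + r2)%N in let n3 := (13 * q3 + r3)%N in
  alive n0 n1 n2 n3 ->
  all p (children (state q0 q1 q2 q3)) -> p (state n0 n1 n2 n3).
Proof.
move=> lt0 lt1 lt2 lt3 n0 n1 n2 n3 [le01 le12 long small bal balN].
have table0 : nth [::] prefix_table (Z.to_nat 0) = prefixes (fomega q0 - fomega q0).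
  by rewrite subrr.
rewrite /children {1}/state table0 !prefix_tableE.
set l := (_ - _)%Z; set g := (_ - _)%Z; set e := excess _ _ _ _.
set e' := excess n0 n1 n2 n3 in small.
have El : (13 * l + Z.of_nat r1 - Z.of_nat r0 = Z.of_nat n1 - Z.of_nat n0)%Z.
  by rewrite /l /n0 /n1; lia.
have Eg : (13 * g + Z.of_nat r2 - Z.of_nat r1 = Z.of_nat n2 - Z.of_nat n1)%Z.
  by rewrite /g /n1 /n2; lia.
have Ee : (Z.of_nat r1 + Z.of_nat r2 - Z.of_nat r0 - 13 * e =
           Z.of_nat r3 - e')%Z.
  by rewrite /e /e' /excess /n0 /n1 /n2 /n3; lia.
move=> /(all_prefixes lt0); rewrite {1}/prefix_row.
move=> /(all_prefixes lt1); rewrite {1}/prefix_row El.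
case: ifP => [/Z.ltb_spec0|_]; first by lia.
case: ifP => [/Z.leb_spec0|_]; first by lia.
move=> /(all_prefixes lt2); rewrite {1}/prefix_row Eg Ee.
case: ifP => [/Z.ltb_spec0|_]; first by lia.
case: ifP => [/Z.leb_spec0|_]; first by lia.
case: ifP => [/Z.ltb_spec0|_]; first by lia.
case: ifP => [/Z.ltb_spec0|_]; first by lia.
have pick (F : Z -> seq (seq Z)) :
    all p (flatten [seq F x | x <- [:: (-1)%Z; 0%Z; 1%Z]]) -> all p (F e').
  rewrite all_flatten => /and4P[? ? ? _].
  by have [->|[->|->]] : (e' = -1 \/ e' = 0 \/ e' = 1)%Z by lia.
move=> /pick; rewrite Z.sub_add.
case: ifP => [/Z.ltb_spec0|_]; first by lia.
case: ifP => [/Z.leb_spec0|_]; first by lia.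
rewrite Nat2Z.id (nth_map 0%N) ?size_iota // nth_iota // add0n /prefix_row.
rewrite -map_comp !addsub_map.
have -> : [seq (5 * defect (pred1 (b + fomega q0)%R) q0 q1 q2 q3 + e +
      Z.of_nat (count_mem b [seq (a + (fomega q0 - fomega q0))%R | a <- take r0 f0]) -
      Z.of_nat (count_mem b [seq (a + (fomega q1 - fomega q0))%R | a <- take r1 f0]) +
      Z.of_nat (count_mem b [seq (a + (fomega q3 - fomega q0))%R | a <- take r3 f0]) -
      Z.of_nat (count_mem b [seq (a + (fomega q2 - fomega q0))%R | a <- take r2 f0]))%Z
    | b <- letters] =
    [seq defect (pred1 (b + fomega q0)) n0 n1 n2 n3 | b <- letters].
  apply: eq_map => b; rewrite /n0 /n1 /n2 /n3 defect_block // card1.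
  by rewrite !(block_count_letter q0); lia.
have -> : norm_le 4 [seq defect (pred1 (b + fomega q0)) n0 n1 n2 n3 | b <- letters].
  rewrite (map_comp (fun a => defect (pred1 a) n0 n1 n2 n3)).
  apply: balanced_norm => //.
  by rewrite (map_inj_uniq (addIr (fomega q0))) uniq_letters.
rewrite Nat2Z.id rot_letters -!relative_letter_block //.
suff -> : [seq defect (pred1 (b + f0`_r0 + fomega q0)) n0 n1 n2 n3 | b <- letters] =
          [seq defect (pred1 (b + fomega n0)) n0 n1 n2 n3 | b <- letters].
  by rewrite /= andbT.
by apply: eq_map => b; rewrite fomega_block // -addrA (addrC f0`_r0).
Qed.

Lemma mem_state_all (p : pred (seq Z)) S s : mem_state S s -> all p S -> p s.
Proof.
have eqP (u v : seq Z) : all2 Z.eqb u v -> u = v.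
  by elim: u v => [|x u IHu] [|y v] //= /andP[/Z.eqb_spec -> /IHu ->].
by elim: S => //= t S IHS /orP[/eqP ->|/IHS IH] /andP[].
Qed.

(** Division by 13 decreases the sum of the positions until all four are 0. *)
Lemma state_in_states n0 n1 n2 n3 :
  alive n0 n1 n2 n3 -> mem_state states (state n0 n1 n2 n3).
Proof.
have [m] := ubnP (n0 + n1 + n2 + n3)%N.
elim: m n0 n1 n2 n3 => // m IHm n0 n1 n2 n3 lt_m live.
have [n0E|n_gt0] := posnP (n0 + n1 + n2 + n3)%N.
  have [-> [-> [-> ->]]] : n0 = 0%N /\ n1 = 0%N /\ n2 = 0%N /\ n3 = 0%N by lia.
  by vm_compute.
have lt_r n : (n %% 13 < 13)%N by rewrite ltn_mod.
have E n : (13 * (n %/ 13) + n %% 13)%N = n by rewrite mulnC -divn_eq.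
have live_E : alive (13 * (n0 %/ 13) + n0 %% 13) (13 * (n1 %/ 13) + n1 %% 13)
    (13 * (n2 %/ 13) + n2 %% 13) (13 * (n3 %/ 13) + n3 %% 13) by rewrite !E.
have lt_q : (n0 %/ 13 + n1 %/ 13 + n2 %/ 13 + n3 %/ 13 < m)%N by lia.
have in_q := IHm _ _ _ _ lt_q
  (alive_parent (lt_r _) (lt_r _) (lt_r _) (lt_r _) live_E).
have := children_state (lt_r _) (lt_r _) (lt_r _) (lt_r _) live_E
  (mem_state_all in_q states_closed).
by rewrite !E.
Qed.

(** * Anagrams in the infinite word *)

Lemma prefix_count_size P n u v :
  mkseq fomega n = u ++ v -> prefix_count P (size u) = Z.of_nat (count P u).
Proof.
move=> E; have le_n : (size u <= n)%N.
  by rewrite -(size_mkseq fomega n) E size_cat leq_addr.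
rewrite /prefix_count; congr (Z.of_nat (count P _)).
rewrite -[RHS](take_size_cat v (erefl (size u))) -E /mkseq -map_take.
by rewrite take_iota (minn_idPl le_n).
Qed.

(** Were X1 longer than this, its four positions would be alive with vanishing
    defect, against [states_harmless]. *)
Lemma anagram_length X1 Y X2 :
  factor_infinite (X1 ++ Y ++ X2) fomega -> anagram X1 X2 ->
  (size X1 <= 3 * size Y)%N.
Proof.
move=> [n /infixP[s [t E]]] /anagramP eqX; rewrite leqNgt; apply/negP => long.
pose n0 := size s; pose n1 := size (s ++ X1); pose n2 := size (s ++ X1 ++ Y).
pose n3 := size (s ++ X1 ++ Y ++ X2).
have defect0 P : defect P n0 n1 n2 n3 = 0%Z.
  have count_upto u v : s ++ (X1 ++ Y ++ X2) ++ t = u ++ v ->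
      prefix_count P (size u) = Z.of_nat (count P u).
    by rewrite -E; apply: prefix_count_size.
  rewrite /defect (count_upto _ _ erefl) (count_upto (s ++ X1) (Y ++ X2 ++ t));
    last by rewrite -!catA.
  rewrite (count_upto (s ++ X1 ++ Y) (X2 ++ t)); last by rewrite -!catA.
  rewrite (count_upto (s ++ X1 ++ Y ++ X2) t); last by rewrite -!catA.
  rewrite !count_cat (permP eqX P).
  by move: (count P s) (count P X2) (count P Y) => *; lia.
have size_eq : size X1 = size X2 by apply: perm_size.
have live : alive n0 n1 n2 n3.
  split; try (move: size_eq long; rewrite /excess /n0 /n1 /n2 /n3 ?size_cat;
    move: (size s) (size X1) (size Y) (size X2) => ? ? ? ?; by lia).
  - by move=> A _ _; rewrite defect0.
  - by move=> A _ _; rewrite defect_swap defect0.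
have := mem_state_all (state_in_states live) states_harmless.
rewrite /harmless /state all_map.
rewrite (@eq_all _ _ predT) ?all_predT => [|b]; last by rewrite /= defect0.
move=> /Z.leb_spec0; move: long; rewrite /n0 /n1 /n2 !size_cat.
by move: (size s) (size X1) (size Y) => *; lia.
Qed.

Theorem theorem1 :
  ~ exists X1 Y X2 : word,
      [/\ factor_infinite (X1 ++ Y ++ X2) fomega,
          X1 ++ Y <> [::],
          anagram X1 X2 &
          (size (X1 ++ Y ++ X2))%:R / (size (X1 ++ Y))%:R
            > 876775%:R / 489527%:R :> rat].
Proof.
move=> [X1 [Y [X2 [facX nonempty eqX]]]].
have lt74 : 7%:R / 4%:R < 876775%:R / 489527%:R :> rat by lra.
move=> /(lt_trans lt74) {lt74}.
have leX := anagram_length facX eqX.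
have /anagramP/perm_size size_eq := eqX.
have size_gt0 : (0 < size (X1 ++ Y))%N by rewrite lt0n size_eq0; apply/eqP.
rewrite ltr_pdivlMr ?ltr0n // !size_cat -size_eq !natrD.
have {leX} : (size X1)%:R <= 3 * (size Y)%:R :> rat by rewrite -natrM ler_nat.
have : 0 <= (size Y)%:R :> rat by apply: ler0n.
by move: (size X1)%:R (size Y)%:R => x y; lra.
Qed.
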